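(* Let $S\leq T(X)$ with $IF(X)\subseteq S$. Then the following statements are equivalent: (i) $S$ is a maximal subsemigroup of $T(X)$. (ii) $S=T(X)\setminus H$ for some $H\in\mathcal{H}(Inj(X)\cap FI(X),IF(X))$.
   Context: $X$ is a countably infinite set (one may take $X=\mathbb{N}$) and $T(X)$ is the monoid of all full transformations (maps $X\to X$) under composition. $A\leq B$ means that $A$ is a subsemigroup of $B$; $\langle A\rangle$ is the subsemigroup generated by $A$. A subsemigroup $S$ of $T(X)$ is maximal if $S\neq T(X)$ and there is no subsemigroup of $T(X)$ lying strictly between $S$ and $T(X)$. For $\alpha\in T(X)$: $im\,\alpha$ is its range, $rank(\alpha)=|im\,\alpha|$, the defect is $d(\alpha)=|X\setminus im\,\alpha|$, and the collapse is $c(\alpha)=\sum_{y\in im\,\alpha}(|y\alpha^{-1}|-1)$, where $y\alpha^{-1}$ is the preimage of $y$. $Inj(X)=\{\alpha\in T(X)\mid rank(\alpha)=\aleph_0,\ c(\alpha)=0,\ d(\alpha)\neq 0\}$; $IF(X)=\{\alpha\in T(X)\mid rank(\alpha)=\aleph_0,\ c(\alpha)=\aleph_0,\ d(\alpha)<\aleph_0\}$ (a subsemigroup of $T(X)$); $FI(X)=\{\alpha\in T(X)\mid rank(\alpha)=\aleph_0,\ d(\alpha)=\aleph_0,\ c(\alpha)<\aleph_0\}$. For a set $M$ of subsets of $T(X)$, let $J(M)$ be the set of all $A\subseteq T(X)$ such that: $A\subseteq\bigcup M=\{a\mid \exists m\in M,\ a\in m\}$; $A\cap m\neq\emptyset$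 for all $m\in M$; and for every $\alpha\in A$ there exists $m\in M$ with $A\cap m=\{\alpha\}$. For $U\subseteq T(X)$ and $W\leq T(X)$ put $Gen(U)=\{A\subseteq T(X)\mid A \text{ is finite and } \langle A\rangle\cap U\neq\emptyset\}$ and $\mathcal{H}(U,W)=\{A\subseteq T(X)\setminus W\mid A\in J(Gen(U))\}$. *)

(* Defs.v *)
From mathcomp Require Import all_boot all_order all_algebra.
From mathcomp Require Import all_classical all_reals all_analysis.
From mathcomp Require Import Rstruct.

Set Implicit Arguments.
Unset Strict Implicit.
Unset Printing Implicit Defensive.

Local Open Scope classical_set_scope.

Section Transformations.
Variable X : choiceType.

(* The full transformation monoid T(X) is [set: X -> X].  Maps act on the
   right, so the product "first a, then b" is a \; b. *)
Definition subsemigroup (S : set (X -> X)) : Prop :=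
  forall a b, S a -> S b -> S (a \; b).

Definition generated (A : set (X -> X)) : set (X -> X) :=
  smallest subsemigroup A.

Definition maximal_subsemigroup (S : set (X -> X)) : Prop :=
  [/\ subsemigroup S,
      S <> [set: X -> X] &
      ~ exists T : set (X -> X), [/\ subsemigroup T, S `<` T & T `<` [set: X -> X]]].

(* Cardinals of sets over a countable X are recorded as extended reals: n for a
   set with n elements and +oo for an infinite one.  These definitions are meant
   for countable X, where +oo stands for aleph_0 and nothing else. *)
Definition cardinal (A : set X) : \bar Rdefinitions.R := counting A.

Definition rank (a : X -> X) : \bar Rdefinitions.R := cardinal (range a).

Definition defect (a : X -> X) : \bar Rdefinitions.R := cardinal (~` range a).

Definition collapse (a : X -> X) : \bar Rdefinitions.R :=
  (\esum_(y in range a) (cardinal (a @^-1` [set y]) - 1)%E)%R.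

Definition Inj_set : set (X -> X) :=
  [set a | [/\ rank a = +oo%E, collapse a = 0%E & defect a <> 0%E]].

Definition IF_set : set (X -> X) :=
  [set a | [/\ rank a = +oo%E, collapse a = +oo%E & (defect a < +oo)%E]].

Definition FI_set : set (X -> X) :=
  [set a | [/\ rank a = +oo%E, defect a = +oo%E & (collapse a < +oo)%E]].

Definition J (M : set (set (X -> X))) : set (set (X -> X)) :=
  [set A | [/\ A `<=` \bigcup_(m in M) m,
               forall m, M m -> A `&` m !=set0 &
               forall a, A a -> exists2 m, M m & A `&` m = [set a]]].

Definition Gen (U : set (X -> X)) : set (set (X -> X)) :=
  [set A | finite_set A /\ generated A `&` U !=set0].

Definition calH (U W : set (X -> X)) : set (set (X -> X)) :=
  [set A | A `<=` ~` W /\ J (Gen U) A].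

End Transformations.

Arguments Inj_set : clear implicits.
Arguments IF_set : clear implicits.
Arguments FI_set : clear implicits.

(* Main.v *)
Require Import Defs.
From mathcomp Require Import all_boot all_order all_algebra.
From mathcomp Require Import all_classical all_reals all_analysis.
From mathcomp Require Import finmap Rstruct.
Local Open Scope classical_set_scope.

(** If u is injective with infinite defect, then every b factors as u followed
    by some g in IF(X): on the image of u the values of g are prescribed, and on
    its infinite complement g can be chosen with all fibres infinite.  Hence a
    subsemigroup containing IF(X) is proper iff it misses
    U = Inj(X) `&` FI(X).  A maximal S is therefore one that misses U while
    adjoining any further element produces a member of U; since membership in a
    generated subsemigroup only involves finitely many generators, this says
    that the complement of S is an irredundant transversal of Gen(U). *)

Lemma subsemigroup_generated {X : choiceType} (A : set (X -> X)) :
  subsemigroup (generated A).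
Proof.
move=> a b ga gb B [sB AB].
exact: sB (ga _ (conj sB AB)) (gb _ (conj sB AB)).
Qed.

Lemma sub_generated {X : choiceType} (A : set (X -> X)) : A `<=` generated A.
Proof. exact: sub_gen_smallest. Qed.

Lemma generated_sub {X : choiceType} (A S : set (X -> X)) :
  subsemigroup S -> A `<=` S -> generated A `<=` S.
Proof. exact: smallest_sub. Qed.

Lemma generatedS {X : choiceType} (A B : set (X -> X)) :
  A `<=` B -> generated A `<=` generated B.
Proof.
move=> AB; apply: generated_sub; first exact: subsemigroup_generated.
exact: subset_trans AB (sub_generated B).
Qed.

(** Elements generated by finite subsets of [A] form a subsemigroup containing [A]: for a product,
    take the union of the two finite sets. *)
Lemma generated_finitary {X : choiceType} (A : set (X -> X)) (x : X -> X) :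
  generated A x -> exists F, [/\ finite_set F, F `<=` A & generated F x].
Proof.
move: x; apply: generated_sub => [a b [F [finF FA Fa]] [G [finG GA Gb]]|a Aa].
  exists (F `|` G); split; first by rewrite finite_setU.
    by rewrite subUset.
  apply: subsemigroup_generated.
    by apply: generatedS Fa; exact: subsetUl.
  by apply: generatedS Gb; exact: subsetUr.
exists [set a]; split; [exact: finite_set1|by move=> _ ->|].
exact: sub_generated.
Qed.

Lemma cardinal_infinite {X : choiceType} (A : set X) :
  cardinal A = +oo%E <-> infinite_set A.
Proof.
by rewrite /cardinal /counting; case: ifPn => /asboolP finA; split.
Qed.

Lemma cardinal0 {X : choiceType} : cardinal (@set0 X) = 0%E.
Proof. by rewrite /cardinal /counting asboolT ?fset_set0// cardfs0. Qed.

Lemma cardinal1 {X : choiceType} (x : X) : cardinal [set x] = 1%E.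
Proof. by rewrite /cardinal /counting asboolT ?fset_set1// cardfs1. Qed.

Lemma cardinal_le1 {X : choiceType} (A : set X) (x y : X) :
  (cardinal A <= 1)%E -> A x -> A y -> x = y.
Proof.
rewrite /cardinal /counting; case: ifPn => /asboolP finA //.
rewrite lee_fin (@Num.Theory.ler_nat _ _ 1) => le1 Ax Ay.
apply/eqP; apply: contraT => xy; rewrite -(ltnn 1).
apply: leq_trans le1; apply: (@uniq_leq_size _ [:: x; y]) => [|z].
  by rewrite /= inE xy.
by rewrite !inE => /orP[] /eqP ->; rewrite in_fset_set//; exact: mem_set.
Qed.

(** The sum is a supremum over finite sets of indices, so the singleton of [y] already gives the
    bound. *)
Lemma le_fiber_collapse {X : choiceType} (a : X -> X) (y : X) :
  range a y -> (cardinal (a @^-1` [set y]) - 1 <= collapse a)%E.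
Proof.
move=> ry; apply: esum_ge; exists [set y]; last by rewrite fsbig_set1.
by split; [exact: finite_set1|move=> _ ->].
Qed.

Lemma collapse0_inj {X : choiceType} (a : X -> X) :
  collapse a = 0%E <-> injective a.
Proof.
split=> [c0 x y axy|inja].
  apply: (@cardinal_le1 _ (a @^-1` [set a y])) => //.
  have := @le_fiber_collapse _ a (a y) (imageT a y).
  by rewrite c0 leeBlDr// add0e.
apply: esum1 => _ [x _ <-].
have -> : a @^-1` [set a x] = [set x].
  by apply/seteqP; split => [y /inja ->|y ->].
by rewrite cardinal1 subee.
Qed.

Lemma Inj_FI_P {X : choiceType} (a : X -> X) : infinite_set [set: X] ->
  (Inj_set X `&` FI_set X) a <-> injective a /\ infinite_set (~` range a).
Proof.
move=> infX; split=> [[[_ c0 _] [_ d _]]|[inja infa]].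
  by split; [exact/collapse0_inj|exact/cardinal_infinite].
have c0 : collapse a = 0%E by exact/collapse0_inj.
have d : defect a = +oo%E by exact/cardinal_infinite.
have r : rank a = +oo%E.
  (* Infinite rank is automatic: a finite range would have a finite preimage under the injective
     [a], and that preimage is all of [X]. *)
  apply/cardinal_infinite => fina; apply: infX.
  have := finite_preimage (in2W inja) fina.
  rewrite (_ : a @^-1` range a = setT)//.
  by apply/seteqP; split=> // x _; exists x.
by split; split=> //; rewrite ?c0 ?d ?ltry.
Qed.

Lemma surj_infinite_fiber_IF {X : choiceType} (a : X -> X) (y : X) :
  infinite_set [set: X] -> range a = setT -> infinite_set (a @^-1` [set y]) ->
  IF_set X a.
Proof.
move=> infX ra infy; split.
- by apply/cardinal_infinite; rewrite ra.
- apply/eqP; rewrite -leye_eq.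
  have := @le_fiber_collapse _ a y; rewrite ra => /(_ Logic.I).
  by have /cardinal_infinite -> := infy.
- by rewrite /defect ra setCT cardinal0.
Qed.

Lemma denumerable_bij {X : choiceType} : ([set: X] #= [set: nat])%card ->
  exists (f : X -> nat) (g : nat -> X), cancel f g /\ cancel g f.
Proof.
move=> /card_set_bijP[f [_ injf surjf]].
have /boolp.choice[g fg] : forall n, exists x, f x = n.
  by move=> n; have [x _ <-] := surjf n Logic.I; exists x.
exists f, g; split=> // x; apply: injf; rewrite ?fg ?in_setT//.
Qed.

(** Index [D] by pairs of naturals: the first component selects the value of [h], the second
    supplies infinitely many points with that value. *)
Lemma infinite_fibers_on {X : choiceType} (D : set X) :
  ([set: X] #= [set: nat])%card -> infinite_set D ->
  exists h : X -> X, forall y, infinite_set (D `&` h @^-1` [set y]).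
Proof.
move=> hX infD.
have cD : countable D.
  have /sub_countable : (D #<= [set: X])%card by exact: subset_card_le.
  by rewrite (eq_countable hX); apply; exact: countableP.
have /card_set_bijP[k [_ _ surjk]] : (D #= [set: nat * nat])%card.
  by rewrite (card_eq_trans (eq_card_nat cD infD))// card_eq_sym card_nat2.
have [f [g [fK _]]] := denumerable_bij hX.
exists (fun x => g (k x).1) => y fin.
apply: infinite_nat.
apply: sub_finite_set (finite_image (fun x => (k x).2) fin) => n _.
have [x Dx kx] := surjk (f y, n) Logic.I.
by exists x; [split=> //=; rewrite kx fK|rewrite kx].
Qed.

Lemma Inj_FI_nonempty {X : choiceType} :
  ([set: X] #= [set: nat])%card -> (Inj_set X `&` FI_set X) !=set0.
Proof.
move=> hX; have [f [g [fK gK]]] := denumerable_bij hX.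
have infX : infinite_set [set: X].
  by rewrite (eq_finite_set hX); exact: infinite_nat.
(* Doubling on the naturals, transported to [X]; it misses all points of odd index, and halving the
   index maps these onto the naturals. *)
exists (fun x => g (f x).*2); apply/Inj_FI_P => //; split=> [x y|fin].
  by move=> /(can_inj gK) /double_inj /(can_inj fK).
apply: infinite_nat; apply: sub_finite_set (finite_image (fun x => (f x)./2) fin).
move=> n _; exists (g n.*2.+1); last by rewrite gK /= uphalf_double.
by move=> [x _ /(can_inj gK)] /(congr1 odd); rewrite /= !odd_double.
Qed.

Lemma subsemigroup_IF_full {X : choiceType} (S : set (X -> X)) (u : X -> X) :
  ([set: X] #= [set: nat])%card -> subsemigroup S -> IF_set X `<=` S ->
  (Inj_set X `&` FI_set X) u -> S u -> S = [set: X -> X].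
Proof.
move=> hX sS IFS Uu Su; apply/seteqP; split=> // b _.
have infX : infinite_set [set: X].
  by rewrite (eq_finite_set hX); exact: infinite_nat.
have /(Inj_FI_P _ infX)[inju infu] := Uu.
have [h infh] := infinite_fibers_on _ hX infu.
have [g [gu gh]] : exists g : X -> X, (forall x, g (u x) = b x) /\
    (forall x, ~ range u x -> g x = h x).
  (* On the range of [u], injectivity makes the chosen preimage the only one, so [g] is forced
     there; elsewhere it follows [h], which makes every fibre infinite. *)
  exists (fun x =>
    if pselect (range u x) is left ux then b (sval (cid2 ux)) else h x).
  split=> x; last by case: pselect.
  case: pselect => [ux|[]]; last exact: imageT.
  by case: cid2 => /= y _ /inju ->.
have infg y : infinite_set (g @^-1` [set y]).
  by apply: sub_infinite_set (infh y) => x [/= /gh ->].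
have -> : b = u \; g by apply/funext => x /=; rewrite gu.
apply: sS => //; apply: IFS.
(* Any point serves as [x0]: all fibres of [g] are infinite, hence nonempty, so [g] is surjective as
   well. *)
have [x0 _] := infinite_setN0 infX.
apply: (@surj_infinite_fiber_IF _ g x0) => //.
by apply/seteqP; split=> // y _; have [x] := infinite_setN0 (infg y); exists x.
Qed.

Theorem proposition15 (X : choiceType) (hX : ([set: X] #= [set: nat])%card)
    (S : set (X -> X)) (hS : subsemigroup S) (hIF : IF_set X `<=` S) :
  maximal_subsemigroup S <->
  exists2 H, calH (Inj_set X `&` FI_set X) (IF_set X) H & S = [set: X -> X] `\` H.
Proof.
have [u Uu] := Inj_FI_nonempty hX.
split=> [[_ SnT maxS]|[H [_ [_ hit irr]] SE]].
  have missU x : (Inj_set X `&` FI_set X) x -> ~ S x.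
    by move=> Ux Sx; apply: SnT; exact: subsemigroup_IF_full _ _ hX hS hIF Ux Sx.
  have adjoin a : ~ S a -> generated (S `|` [set a]) = [set: X -> X].
    move=> Sa; apply: contrapT => nT; apply: maxS.
    exists (generated (S `|` [set a])); split.
    - exact: subsemigroup_generated.
    - split; first exact: subset_trans (@subsetUl _ _ _) (@sub_generated _ _).
      by move/(_ a) => /(_ (sub_generated _ _ (or_intror erefl))).
    - split=> // /(_ _ Logic.I) TS; apply: nT.
      by apply/seteqP; split=> // x _; exact: TS.
  exists (~` S); last by rewrite setTD setCK.
  split; first exact: subsetC.
  split=> [a _|F [finF [x [Fx Ux]]]|a Sa].
  (* Adding [u] puts any [a] into a member of [Gen], so the covering condition holds for every
     set. *)
  - exists [set a; u]; last by left.
    split; first by rewrite finite_setU.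
    by exists u; split=> //; apply: sub_generated; right.
  - apply: contrapT => FS; apply: (missU _ Ux).
    apply: generated_sub Fx => // y Fy.
    by apply: contrapT => Sy; apply: FS; exists y.
  - have [F [finF FSa Fu]] : exists F,
        [/\ finite_set F, F `<=` S `|` [set a] & generated F u].
      by apply: generated_finitary; rewrite adjoin.
    (* [F] lies in [S] apart from possibly [a]; adding [a] makes the intersection with the
       complement of [S] exactly the singleton. *)
    exists (F `|` [set a]).
      split; first by rewrite finite_setU.
      by exists u; split=> //; apply: generatedS Fu; exact: subsetUl.
    apply/seteqP; split=> [x [Sx [/FSa[]//|//]]|_ ->].
    by split=> //; right.
split=> //.
  (* The singleton of [u] belongs to [Gen], so [H] must contain [u] and [S] is proper. *)
  move=> ST; have [x [Hx xu]] : H `&` [set u] !=set0.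
    apply: hit; split; first exact: finite_set1.
    by exists u; split=> //; exact: sub_generated.
  by have := Logic.I : [set: X -> X] x; rewrite -ST SE => -[].
move=> [T [sT [ST nTS] [_ nT]]]; apply: nT.
have [a Ta Sa] : exists2 a, T a & ~ S a.
  apply: contrapT => h; apply: nTS => a Ta; apply: contrapT => Sa; apply: h.
  by exists a.
have Ha : H a by apply: contrapT => Ha; apply: Sa; rewrite SE.
(* [F] meets [H] only in [a], so [F] lies in [T]; then [T] contains the element [x] of [Inj_set X]
   and [FI_set X], which forces [T] to be everything. *)
have [F [_ [x [Fx Ux]]] HF] := irr a Ha.
suff Tx : T x by rewrite (subsemigroup_IF_full _ _ hX sT (subset_trans hIF ST) Ux Tx).
apply: generated_sub Fx => // y Fy.
have [Hy|Hy] := pselect (H y); last by apply: ST; rewrite SE.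
by have : (H `&` F) y by []; rewrite HF => ->.
Qed.
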